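(* There is a randomized algorithm in the $\mathcal{LOCAL}$ model of distributed computation that takes $O(\log^2 n)$ rounds and gives an $O(\log n)$-approximation for Minimum Cost $r$-Fault Tolerant $2$-Spanner.
   Context: $\mathcal{LOCAL}$ model: the vertices of the input graph are processors that communicate in synchronous rounds; in each round each vertex may send a message of unbounded size to each neighbor, and communication along an edge is bidirectional even if the graph is directed. Minimum Cost $r$-Fault Tolerant $2$-Spanner: given a directed graph $G=(V,E)$ with $n=|V|$, unit edge lengths, edge costs $c:E\to\mathbb{R}_{\ge0}$ and an integer $r\ge0$, find $E'\subseteq E$ of minimum total cost such that $H=(V,E')$ satisfies: for every $F\subseteq V$ with $|F|\le r$ and all $u,v\in V\setminus F$, $d_{H\setminus F}(u,v)\le 2\,d_{G\setminus F}(u,v)$, where $d$ is directed shortest-path distance and $G\setminus F$ is $G$ with the vertices of $F$ and incident edges removed. An $\alpha$-approximation outputs a feasible solution of cost at most $\alpha$ times the optimum. *)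

(* Defs.v *)
From HB Require Import structures.
From mathcomp Require Import all_boot all_order all_algebra.
From mathcomp Require Import boolp reals.
Set Implicit Arguments. Unset Strict Implicit. Unset Printing Implicit Defensive.
Import Order.TTheory GRing.Theory Num.Theory.
Local Open Scope ring_scope.

Definition del_vertices n (e : rel 'I_n) (F : {set 'I_n}) : rel 'I_n :=
  fun a b => [&& e a b, a \notin F & b \notin F].

Definition dist_le n (e : rel 'I_n) (u v : 'I_n) (k : nat) : Prop :=
  exists p : seq 'I_n, [/\ path e u p, last u p = v & (size p <= k)%N].

(* H is an r-fault tolerant 2-spanner of G:
   for every F with |F| <= r and all u v not in F,
   d_{H\F}(u,v) <= 2 d_{G\F}(u,v)   (written: d_{G\F}(u,v) <= k implies
   d_{H\F}(u,v) <= 2k for every k, which is exactly the inequality,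
   including the case d_{G\F}(u,v) = infinity). *)
Definition ft2spanner n (G : rel 'I_n) (r : nat) (H : rel 'I_n) : Prop :=
  forall F : {set 'I_n}, (#|F| <= r)%N ->
  forall u v : 'I_n, u \notin F -> v \notin F ->
  forall k : nat, dist_le (del_vertices G F) u v k ->
                  dist_le (del_vertices H F) u v (2 * k).

Definition subgraph n (E' E : rel 'I_n) : Prop := forall u v, E' u v -> E u v.

Definition cost (R : realType) n (c : 'I_n -> 'I_n -> R) (H : rel 'I_n) : R :=
  \sum_(u : 'I_n) \sum_(v : 'I_n | H u v) c u v.

(* Vertices of 'I_n are processors; the ID of vertex v is (val v), so IDs   *)
(* are unique and n is known.  Initially vertex v knows: r, its own ID, the *)
(* costs of its outgoing and incoming edges (None = no such edge), and its  *)
(* own private random bits.  In each synchronous round, every vertex sends  *)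
(* a message (of arbitrary type, i.e. unbounded size) to each neighbour in  *)
(* the underlying undirected graph, then updates its state from the         *)
(* messages received (indexed by sender ID).  After la_rounds rounds, the   *)
(* tail u of each edge (u,v) decides whether (u,v) is in the output E'.     *)
Record local_alg (R : Type) (n : nat) := LocalAlg {
  la_state : Type;
  la_msg : Type;
  la_bits : nat;
  la_rounds : nat;
  la_init : nat -> 'I_n -> ('I_n -> option R) -> ('I_n -> option R) ->
            la_bits.-tuple bool -> la_state;
  la_send : la_state -> 'I_n -> la_msg;
  la_recv : la_state -> ('I_n -> option la_msg) -> la_state;
  la_out : la_state -> 'I_n -> bool
}.

Definition seeds R n (A : local_alg R n) : finType :=
  {ffun 'I_n -> (la_bits A).-tuple bool}.

Section Run.
Variables (R : Type) (n : nat) (A : local_alg R n).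
Variables (E : rel 'I_n) (c : 'I_n -> 'I_n -> R) (r : nat) (rho : seeds A).

Definition adjacent (u v : 'I_n) : bool := E u v || E v u.

Definition view_out (v : 'I_n) : 'I_n -> option R :=
  fun u => if E v u then Some (c v u) else None.
Definition view_in (v : 'I_n) : 'I_n -> option R :=
  fun u => if E u v then Some (c u v) else None.

Definition init_states : 'I_n -> la_state A :=
  fun v => @la_init R n A r v (view_out v) (view_in v) (rho v).

Definition round (s : 'I_n -> la_state A) : 'I_n -> la_state A :=
  fun v => @la_recv R n A (s v)
             (fun u => if adjacent u v then Some (@la_send R n A (s u) v) else None).

Definition final_states : 'I_n -> la_state A := iter (@la_rounds R n A) round init_states.

Definition output : rel 'I_n :=
  fun u v => E u v && @la_out R n A (final_states u) v.
End Run.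

Definition prob (R : realType) (T : finType) (P : T -> Prop) : R :=
  #|[set x : T | `[< P x >]]|%:R / #|T|%:R.
Definition expect (R : realType) (T : finType) (f : T -> R) : R :=
  (\sum_(x : T) f x) / #|T|%:R.

(* Main.v *)
Require Import Defs.
From HB Require Import structures.
From mathcomp Require Import all_boot all_order all_algebra.
From mathcomp Require Import boolp reals.
From mathcomp Require Import zify.
Import Order.TTheory GRing.Theory Num.Theory.
Local Open Scope ring_scope.
Set Implicit Arguments. Unset Strict Implicit. Unset Printing Implicit Defensive.

(** A graph [H] is an [r]-fault tolerant 2-spanner of [G] as soon as every arc
    [(a, b)] of [G] either lies in [H] or is bypassed by more than [r] two-arc
    paths of [H]; for subgraphs of [G] this is also necessary.  Since local
    computation is free, no linear program is needed: in a clustering of the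
    vertices, each cluster can solve optimally the covering constraints of those
    of its vertices whose out-neighbours all lie in the cluster.  The restrictions
    of an optimal spanner to the clusters are feasible and pairwise disjoint, so
    one clustering costs at most OPT, for every outcome of the random bits.

    Clusterings are those of Linial and Saks: every vertex [y] draws a geometric
    radius truncated at [B = O(log n)], and a vertex joins the smallest [y] whose
    ball contains it.  By memorylessness the out-neighbourhood of a given vertex
    is contained in one cluster with constant probability, so in [O(log n)] independent
    clusterings all the constraints are met with probability at least [1 - 1/n],
    at total cost [O(log n)] OPT.  A cluster and its constraints are determined by
    what lies within distance [3 B], hence [O(log n)] rounds of flooding suffice. *)

(** * Fault tolerance as a covering condition on single arcs *)

Definition covered n (r : nat) (H : rel 'I_n) (a b : 'I_n) : bool :=
  H a b || (r < #|[set z | H a z && H z b]|)%N.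

(** The set of midpoints is itself taken as the fault set: the arc [(a, b)] survives in [G], yet no
    path of at most two arcs is left in [H]. *)
Lemma ft2spanner_covered n (G H : rel 'I_n) (r : nat) (a b : 'I_n) :
  ft2spanner G r H -> G a b -> a != b -> covered r H a b.
Proof.
move=> sp Gab neq_ab; rewrite /covered.
case: (boolP (H a b)) => //= nHab; rewrite ltnNge; apply/negP => leZ.
have aZ : a \notin [set z | H a z && H z b].
  by rewrite inE (negbTE nHab) andbF.
have bZ : b \notin [set z | H a z && H z b].
  by rewrite inE (negbTE nHab).
have Gd : dist_le (del_vertices G [set z | H a z && H z b]) a b 1.
  by exists [:: b]; split => //=; rewrite /del_vertices Gab aZ bZ.
case: (sp _ leZ a b aZ bZ 1%N Gd) => p [].
case: p => [|x [|y [|//]]] /=.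
- by move=> _ eab; rewrite eab eqxx in neq_ab.
- by rewrite /del_vertices => /andP[/and3P[Hax _ _] _] exb; rewrite exb (negbTE nHab) in Hax.
- rewrite /del_vertices => /and3P[/and3P[Hax _ xZ] /and3P[Hxy _ _] _] eyb _.
  by rewrite -eyb inE Hax Hxy in xZ.
Qed.

Lemma covered_ft2spanner n (G H : rel 'I_n) (r : nat) :
  (forall a b, G a b -> a != b -> covered r H a b) -> ft2spanner G r H.
Proof.
move=> cov F leF u v uF vF k [p [pth lst sz]].
suff [q [pq lq sq]] : dist_le (del_vertices H F) u v (2 * size p).
  by exists q; split => //; apply: leq_trans sq _; rewrite leq_pmul2l.
elim: p u uF pth lst {k sz} => [|x p IHp] u uF /=; first by move=> _ ->; exists [::].
rewrite {1}/del_vertices => /andP[/and3P[Gux _ xF] pth] lst.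
have [q [pq lq sq]] := IHp x xF pth lst.
(* Loops on the walk are dropped, so only arcs with distinct ends need covering. *)
case: (eqVneq u x) => [->|neq_ux].
  by exists q; split => //; apply: leq_trans sq _; rewrite leq_pmul2l.
case/orP: (cov _ _ Gux neq_ux) => [Hux|ltZ].
  exists (x :: q); split => //=; first by rewrite /del_vertices Hux uF xF.
  by rewrite mulnS; lia.
(* More than [r] midpoints against at most [r] faults: some midpoint survives. *)
have [z] : exists z, z \in [set z | H u z && H z x] :\: F.
  apply/set0Pn; rewrite -card_gt0.
  rewrite -(ltn_add2l #|[set z | H u z && H z x] :&: F|) addn0 cardsID.
  apply: leq_ltn_trans (leq_ltn_trans leF ltZ).
  exact/subset_leq_card/subsetIr.
rewrite !inE => /and3P[zF Huz Hzx].
exists [:: z, x & q]; split => //=; last by rewrite mulnS; lia.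
by rewrite /del_vertices Huz Hzx uF xF zF.
Qed.

(** * Balls, clusters and optimal solutions per cluster *)

Section WeightedDigraph.
Variables (R : realType) (n : nat).
Implicit Types (m : 'I_n -> 'I_n -> option R) (S : {set 'I_n}).
Implicit Types (d : 'I_n -> nat) (H : {set 'I_n * 'I_n}).

Definition adj m : rel 'I_n := fun a b => isSome (m a b) || isSome (m b a).

(** Distance at most [s] in the underlying undirected graph, along which messages travel. *)
Fixpoint near m (s : nat) : rel 'I_n := fun a b =>
  if s is s'.+1 then near m s' a b || [exists u, adj m u a && near m s' u b]
  else a == b.

Lemma adjC m a b : adj m a b = adj m b a.
Proof. exact: orbC. Qed.

Lemma near_leq m s s' a b : (s <= s')%N -> near m s a b -> near m s' a b.
Proof.
move/subnK <-; elim: (s' - s)%N => //= k IHk /IHk ->; exact: orTb.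
Qed.

Lemma near_refl m s a : near m s a a.
Proof. exact: (@near_leq m 0 s a a (leq0n _) (eqxx a)). Qed.

Lemma near_trans m s s' a b c :
  near m s a b -> near m s' b c -> near m (s + s') a c.
Proof.
elim: s a => [|s IHs] a /=; first by move/eqP->.
case/orP => [nab nbc|/existsP[u /andP[ua nub]] nbc].
  by rewrite (IHs a nab nbc).
by apply/orP; right; apply/existsP; exists u; rewrite ua (IHs u nub nbc).
Qed.

Lemma near_adj m a b : adj m a b -> near m 1 a b.
Proof.
by move=> ab; apply/orP; right; apply/existsP; exists b; rewrite adjC ab /=.
Qed.

Lemma near_sym m s a b : near m s a b -> near m s b a.
Proof.
elim: s a => [|s IHs] a /=; first by rewrite eq_sym.
case/orP => [nab|/existsP[u /andP[ua nub]]]; first by rewrite IHs.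
by have := near_trans (IHs _ nub) (near_adj ua); rewrite addn1.
Qed.

(** A walk of [s] steps from [w] stays within [j + s] of [v], so every arc it inspects touches the
    ball where [m] and [m'] agree. *)
Lemma near_eq m m' t v s j w x :
  (forall a b, near m t v a -> m a b = m' a b /\ m b a = m' b a) ->
  near m j v w -> (j + s <= t)%N -> near m s w x = near m' s w x.
Proof.
move=> agr; elim: s j w x => [//|s IHs] j w x nvw les /=.
rewrite -(IHs j) //; last by lia.
congr orb; apply: eq_existsb => u.
have [e1 e2] : m w u = m' w u /\ m u w = m' u w.
  by apply: agr; apply: near_leq nvw; lia.
rewrite /adj -e1 -e2; case: (boolP (_ || _)) => //= uw.
apply: (IHs (j + 1)%N); last by lia.
by apply: near_trans nvw _; apply: near_adj; rewrite adjC.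
Qed.

Definition center m d (w : 'I_n) : 'I_n :=
  [arg min_(y < w | near m (d y) w y) val y].

Lemma near_center m d w : near m (d (center m d w)) w (center m d w).
Proof. by rewrite /center; case: arg_minnP => //; exact: near_refl. Qed.

Lemma center_min m d w y :
  near m (d y) w y -> (forall x : 'I_n, (x < y)%N -> ~~ near m (d x) w x) ->
  center m d w = y.
Proof.
rewrite /center; case: arg_minnP => [|z nz zmin ny ymin]; first exact: near_refl.
apply: val_inj; apply/eqP; rewrite eqn_leq zmin //= leqNgt.
by apply/negP => /ymin; rewrite nz.
Qed.

Definition cluster m d (v : 'I_n) : {set 'I_n} :=
  [set w | center m d w == center m d v].

(* [best] is applied to [mask S m], so that the chosen solution depends only on
   arcs incident to [S]. *)
Definition mask S m : 'I_n -> 'I_n -> option R :=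
  fun a b => if (a \in S) || (b \in S) then m a b else None.

(* Vertices of [S] with an out-neighbour outside [S] impose no constraint. *)
Definition solves (r : nat) m S H : bool :=
  [forall a in S, [forall z, isSome (m a z) ==> (z \in S)] ==>
    [forall b, isSome (m a b) && (a != b) ==>
      covered r (fun x y => isSome (m x y) && ((x, y) \in H)) a b]].

Definition weight m H : R := \sum_a \sum_(b | (a, b) \in H) odflt 0 (m a b).

Definition best (r : nat) m S : {set 'I_n * 'I_n} :=
  [arg min_(H < setT | solves r m S H) weight m H]%O.

Lemma solvesT r m S : solves r m S setT.
Proof.
apply/forall_inP => a aS; apply/implyP => _; apply/forallP => b.
by apply/implyP => /andP[mab _]; rewrite /covered mab inE.
Qed.

Lemma best_solves r m S : solves r m S (best r m S).
Proof. by rewrite /best; case: arg_minP => //; exact: solvesT. Qed.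

Lemma best_min r m S H : solves r m S H -> weight m (best r m S) <= weight m H.
Proof. by rewrite /best; case: arg_minP => [|H' _ min /min //]; exact: solvesT. Qed.

(** The tail decides: the arc is kept if the solution of the tail's own cluster uses it in some
    clustering. *)
Definition pieces (K r : nat) m (ds : 'I_K -> 'I_n -> nat) : rel 'I_n :=
  fun v u => [exists k, (v, u) \in
    best r (mask (cluster m (ds k) v) m) (cluster m (ds k) v)].

(** * Clusters and solutions depend only on the ball of radius [3 * B] *)

Section Local.
Variables (m m' : 'I_n -> 'I_n -> option R) (B : nat) (v : 'I_n).
Hypothesis agr : forall a b, near m (3 * B)%N v a -> m a b = m' a b /\ m b a = m' b a.

(** Candidate centers of [w] lie within [B] of [w], hence within [3 * B] of [v], where arcs and
    radii agree. *)
Lemma center_local d d' w :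
  (forall a, (d a <= B)%N) -> (forall a, (d' a <= B)%N) ->
  (forall a, near m (3 * B)%N v a -> d a = d' a) ->
  near m (2 * B)%N v w -> center m d w = center m' d' w.
Proof.
move=> dB d'B dd' vw; rewrite /center; congr (arg_min w _ _).
apply/funext => y.
have nE s : (s <= B)%N -> near m s w y = near m' s w y.
  by move=> sB; apply: (near_eq y agr vw); lia.
have known s : (s <= B)%N -> near m s w y -> d y = d' y.
  by move=> sB wy; apply: dd'; apply: near_leq (near_trans vw wy); lia.
apply/idP/idP => wy.
  by rewrite -(known _ (dB y) wy) -nE.
by move: wy; rewrite -nE // => wy; rewrite (known _ (d'B y) wy).
Qed.

(** Both vertices are within [B] of their common center. *)
Lemma cluster_near m0 d w : (forall a, (d a <= B)%N) ->
  w \in cluster m0 d v -> near m0 (2 * B)%N v w.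
Proof.
move=> dB; rewrite inE => /eqP e.
have := near_center m0 d w; rewrite e => /near_sym wc.
by apply: near_leq (near_trans (near_center m0 d v) wc); have := dB (center m0 d v); lia.
Qed.

Lemma cluster_local d d' :
  (forall a, (d a <= B)%N) -> (forall a, (d' a <= B)%N) ->
  (forall a, near m (3 * B)%N v a -> d a = d' a) ->
  cluster m d v = cluster m' d' v.
Proof.
move=> dB d'B dd'; apply/setP => w.
have cE x : near m (2 * B)%N v x -> center m d x = center m' d' x.
  exact: center_local.
have cv := cE v (near_refl _ _ _).
case: (boolP (near m (2 * B)%N v w)) => vw; first by rewrite !inE cv cE.
have vw' : ~~ near m' (2 * B)%N v w.
  by rewrite -(near_eq w agr (near_refl m 0 v)) //; lia.
by rewrite (contraNF (cluster_near dB) vw) (contraNF (cluster_near d'B) vw').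
Qed.

Lemma pieces_local K r (ds ds' : 'I_K -> 'I_n -> nat) u :
  (forall k a, (ds k a <= B)%N) -> (forall k a, (ds' k a <= B)%N) ->
  (forall k a, near m (3 * B)%N v a -> ds k a = ds' k a) ->
  pieces r m ds v u = pieces r m' ds' v u.
Proof.
move=> dB d'B dd'; apply: eq_existsb => k.
rewrite -(cluster_local (dB k) (d'B k) (dd' k)).
suff -> : mask (cluster m (ds k) v) m = mask (cluster m (ds k) v) m' by [].
apply/funext => a; apply/funext => b; rewrite /mask.
have near3 x : x \in cluster m (ds k) v -> near m (3 * B)%N v x.
  by move/(cluster_near (dB k)); apply: near_leq; lia.
case: ifP => // /orP[/near3 va|/near3 vb]; first by case: (agr b va).
by case: (agr a vb).
Qed.

End Local.

End WeightedDigraph.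

(** * Feasibility and cost of the union of the pieces *)

Section Instance.
Variables (R : realType) (n : nat) (E : rel 'I_n) (c : 'I_n -> 'I_n -> R) (r : nat).

Definition net : 'I_n -> 'I_n -> option R :=
  fun a b => if E a b then Some (c a b) else None.

Lemma isSome_net a b : isSome (net a b) = E a b.
Proof. by rewrite /net; case: (E a b). Qed.

(** Every arc that covers [(a, b)] has as tail [a] or an out-neighbour of [a]; these all lie in one
    cluster, so their decisions come from the same solution. *)
Lemma pieces_covered K (ds : 'I_K -> 'I_n -> nat) a b (k : 'I_K) :
  (forall z, E a z -> center net (ds k) z = center net (ds k) a) ->
  E a b -> a != b ->
  covered r (fun u v => E u v && pieces r net ds u v) a b.
Proof.
move=> pad Eab neq_ab; set S := cluster net (ds k) a.
have aS : a \in S by rewrite inE.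
have inS z : E a z -> z \in S by move=> /pad e; rewrite inE e.
have SE z : z \in S -> cluster net (ds k) z = S.
  by rewrite inE => /eqP e; apply/setP => w; rewrite !inE e.
have maskE x y : x \in S -> mask S net x y = net x y by rewrite /mask => ->.
have pieceI x y : x \in S -> (x, y) \in best r (mask S net) S -> pieces r net ds x y.
  by move=> xS xy; apply/existsP; exists k; rewrite SE.
have := forall_inP (best_solves r (mask S net) S) a aS.
have -> : [forall z, isSome (mask S net a z) ==> (z \in S)].
  by apply/forallP => z; rewrite maskE // isSome_net; apply/implyP; exact: inS.
rewrite implyTb => /forallP /(_ b); rewrite maskE // isSome_net Eab neq_ab /=.
rewrite /covered maskE // isSome_net => /orP[/andP[-> ab]|ltZ].
  by rewrite (pieceI a b).
apply/orP; right; apply: leq_trans ltZ _; apply: subset_leq_card.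
apply/subsetP => z; rewrite !inE maskE // isSome_net => /andP[/andP[Eaz az] zb].
rewrite Eaz pieceI //=.
move: zb; rewrite maskE ?inS // isSome_net => /andP[-> zb].
by rewrite pieceI ?inS.
Qed.

Hypothesis c_ge0 : forall u v, 0 <= c u v.
Variable E' : rel 'I_n.
Hypotheses (sE'E : subgraph E' E) (E'span : ft2spanner E r E').

(** If the out-neighbours of [a] lie in [S], then so do the head and all midpoints in its
    constraints, and restricting [E'] to [S] loses no covering arc. *)
Lemma restriction_solves (S : {set 'I_n}) :
  solves r (mask S net) S [set p | [&& E' p.1 p.2, p.1 \in S & p.2 \in S]].
Proof.
apply/forall_inP => a aS; apply/implyP => /forallP inS.
have maskE x y : x \in S -> mask S net x y = net x y by rewrite /mask => ->.
have {}inS z : E a z -> z \in S.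
  by move=> Eaz; apply: (implyP (inS z)); rewrite maskE // isSome_net.
apply/forallP => b; apply/implyP; rewrite maskE // isSome_net => /andP[Eab neq_ab].
have bS := inS b Eab.
rewrite /covered maskE // isSome_net !inE /= aS bS Eab.
have /orP[-> //|ltZ] := ft2spanner_covered E'span Eab neq_ab.
apply/orP; right; apply: leq_trans ltZ _; apply: subset_leq_card.
apply/subsetP => z; rewrite !inE => /andP[E'az E'zb].
have Eaz := sE'E E'az; have zS := inS z Eaz.
by rewrite !maskE // !isSome_net /= aS bS zS E'az E'zb Eaz sE'E.
Qed.

Lemma cell_cost (S : {set 'I_n}) :
  \sum_(v in S) \sum_(u | E v u && ((v, u) \in best r (mask S net) S)) c v u
  <= \sum_(v in S) \sum_(u | E' v u) c v u.
Proof.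
have w_ge0 a b : 0 <= odflt 0 (mask S net a b).
  by rewrite /mask /net; case: ifP => // _; case: ifP => //=.
apply: (@le_trans _ _ (weight (mask S net) (best r (mask S net) S))).
  rewrite /weight [leRHS](bigID (mem S)) /=.
  rewrite ler_wpDr ?sumr_ge0 //; first by move=> i _; exact: sumr_ge0.
  apply: ler_sum => v vS; rewrite big_mkcond [leRHS]big_mkcond /=.
  apply: ler_sum => u _; rewrite /mask vS /net.
  by case: (E v u); case: (_ \in _).
apply: le_trans (best_min (restriction_solves S)) _.
rewrite /weight [leLHS](bigID (mem S)) /=.
rewrite [X in _ + X]big1 ?addr0; last first.
  move=> v vS; rewrite big1 // => u; rewrite inE /= (negbTE vS) andbF.
  by [].
apply: ler_sum => v vS; rewrite big_mkcond [leRHS]big_mkcond /=.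
apply: ler_sum => u _; rewrite inE /= /mask vS /net.
case: (boolP (E' v u)) => //= E'vu; rewrite (sE'E E'vu) /=.
by case: (_ \in _) => //=.
Qed.

(** The clusters of one clustering partition the tails, so the bounds of [cell_cost] add up to the
    cost of [E']; summing over the [K] clusterings gives the factor. *)
Lemma pieces_cost K (ds : 'I_K -> 'I_n -> nat) :
  cost c (fun u v => E u v && pieces r net ds u v) <= K%:R * cost c E'.
Proof.
pose F k v := \sum_(u | E v u && ((v, u) \in
  best r (mask (cluster net (ds k) v) net) (cluster net (ds k) v))) c v u.
apply: (@le_trans _ _ (\sum_k \sum_v F k v)).
  rewrite exchange_big; apply: ler_sum => v _; rewrite /F.
  under [leRHS]eq_bigr => k _ do rewrite big_mkcond.
  rewrite exchange_big big_mkcond; apply: ler_sum => u _ /=.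
  case: ifP => [/andP[Evu /existsP[k vu]]|_]; last first.
    by apply: sumr_ge0 => k _; case: ifP.
  rewrite (bigD1 k) //= Evu vu /= lerDl.
  by apply: sumr_ge0 => k' _; case: ifP.
rewrite -[X in X%:R](card_ord K) mulr_natl -sumr_const.
apply: ler_sum => k _; rewrite /cost.
rewrite (partition_big (center net (ds k)) xpredT) //=.
rewrite [leRHS](partition_big (center net (ds k)) xpredT) //=.
apply: ler_sum => y _; set S := [set v | center net (ds k) v == y].
have eS v : (v \in S) = (center net (ds k) v == y) by rewrite inE.
have := cell_cost S; rewrite !(eq_bigl _ _ eS).
apply: le_trans; apply: ler_sum => v /eqP ey.
have SE : cluster net (ds k) v = S by apply/setP => w; rewrite !inE ey.
by rewrite /F SE.
Qed.

End Instance.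

Lemma card_bigcup_leq (T I : finType) (F : I -> {set T}) :
  (#|\bigcup_i F i| <= \sum_i #|F i|)%N.
Proof.
elim/big_ind2: _ => [|a A b B le_a le_b|//]; first by rewrite cards0.
exact: leq_trans (leq_card_setU A B).1 (leq_add le_a le_b).
Qed.

(** * Truncated geometric radii and memorylessness by counting *)

Section Radii.
Local Open Scope nat_scope.

(* For a uniform [B]-bit string, [rad] is geometric of parameter 1/2 truncated
   at [B]. *)
Definition rad (t : seq bool) : nat := find negb t.

Lemma rad_leq B (t : B.-tuple bool) : rad t <= B.
Proof. by rewrite -[leqRHS](size_tuple t) find_size. Qed.

Lemma leq_radP j (t : seq bool) :
  (j <= rad t) <-> (forall i, i < j -> nth false t i).
Proof.
split=> [jt i ij|bits]; first by apply/negbFE/(before_find false)/(leq_trans ij).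
rewrite leqNgt; apply/negP => /bits; rewrite /rad.
case: (boolP (has negb t)) => [/(nth_find false)|nh]; first by case: nth.
by rewrite nth_default // leqNgt -has_find.
Qed.

Variables (n B : nat).
Local Notation radii := {ffun 'I_n -> B.-tuple bool}.

Definition set2bits (t : B.-tuple bool) (p : nat) : B.-tuple bool :=
  [tuple [|| val i == p, val i == p.+1 | nth false t i] | i < B].

Lemma nth_set2bits t p i : i < B ->
  nth false (set2bits t p) i = [|| i == p, i == p.+1 | nth false t i].
Proof. by move=> iB; rewrite -(tnth_nth _ _ (Ordinal iB)) tnth_mktuple. Qed.

Lemma rad_set2bits (t : B.-tuple bool) p : p <= rad t -> p.+1 < B -> p.+1 < rad (set2bits t p).
Proof.
move=> pt pB; apply/leq_radP => i ip.
rewrite nth_set2bits; last by lia.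
case: (ltnP i p) => ltip; first by move/leq_radP: pt => -> //; rewrite !orbT.
have : (i == p) || (i == p.+1) by lia.
by rewrite orbA => ->.
Qed.

(* The outcomes for which truncation may spoil memorylessness. *)
Definition overflow : {set radii} := [set w : radii | [exists y, B <= (rad (w y)).+1]].

Lemma card_coordinate (y : 'I_n) (A : {set B.-tuple bool}) :
  #|[set w : radii | w y \in A]| * 2 ^ B = #|A| * #|{: radii}|.
Proof.
have -> : #|[set w : radii | w y \in A]| =
    #|family (fun x => if x == y then mem A else mem predT)|.
  apply: eq_card => w; rewrite inE; apply/idP/familyP => [wy x|/(_ y)].
    by case: eqP => [->|].
  by rewrite eqxx.
rewrite card_family foldrE big_map big_enum (bigD1 y) //= eqxx.
rewrite (eq_bigr (fun=> 2 ^ B)) => [|x /negbTE ->]; last first.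
  by rewrite card_tuple card_bool.
rewrite card_ffun card_tuple card_bool -mulnA; congr (_ * _).
rewrite prod_nat_const mulnC -expnS cardC1 card_ord.
by rewrite prednK //; case: y => y; case: (n).
Qed.

(** Overflow at one vertex forces all bits but the last, leaving at most two strings; a union bound
    over the vertices gives [2 * n / 2 ^ B], at most 1/2. *)
Lemma card_overflow : 4 * n <= 2 ^ B -> 2 * #|overflow| <= #|{: radii}|.
Proof.
move=> nB.
pose A := [set t : B.-tuple bool | B <= (rad t).+1].
have A2 : #|A| <= 2.
  rewrite -card_bool -cardsT.
  rewrite -(card_in_imset (f := fun t : B.-tuple bool => nth false t B.-1) (D := mem A)).
    exact/subset_leq_card/subsetT.
  have Arad (t : B.-tuple bool) : t \in A -> B.-1 <= rad t by rewrite inE; lia.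
  move=> t t' /Arad tb /Arad tb' eB; apply/val_inj/(@eq_from_nth _ false).
    by rewrite !size_tuple.
  move=> i; rewrite size_tuple => iB; case: (eqVneq i B.-1) => [-> //|neqi].
  have iB' : i < B.-1 by lia.
  by rewrite (proj1 (leq_radP _ _) tb i iB') (proj1 (leq_radP _ _) tb' i iB').
have ovf : #|overflow| * 2 ^ B <= n * (2 * #|{: radii}|).
  apply: (@leq_trans ((\sum_(y < n) #|[set w : radii | w y \in A]|) * 2 ^ B)).
    rewrite leq_mul2r; apply/orP; right.
    have -> : overflow = \bigcup_(y < n) [set w : radii | w y \in A].
      apply/setP => w; rewrite inE; apply/existsP/bigcupP => [[y wy]|[y _]].
        by exists y; rewrite ?inE.
      by rewrite !inE => wy; exists y.
    exact: card_bigcup_leq.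
  rewrite big_distrl /= (eq_bigr _ (fun y _ => card_coordinate y A)).
  rewrite sum_nat_const card_ord leq_mul2l leq_mul2r A2 !orbT //.
rewrite -(leq_pmul2r (expn_gt0 2 B)).
nia.
Qed.

Variables (p : 'I_n -> nat) (u : 'I_n).
Hypothesis pu : p u = 0.

(** [p y] stands for the radius at which the ball of [y] begins to touch a fixed region. As
    [p u = 0], the default [u] always qualifies. *)
Definition first_touch (w : radii) : 'I_n := [arg min_(y < u | p y <= rad (w y)) val y].

(** The surplus of two is the diameter bound of a ball of radius 1: a ball that overshoots by it
    contains the unit ball that it touches. *)
Definition sharp : {set radii} :=
  [set w : radii | [exists y, ((p y).+1 < rad (w y)) &&
     [forall x : 'I_n, (x < y) ==> (rad (w x) < p x)]]].

Definition enlarge (w : radii) : radii :=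
  [ffun y => if y == first_touch w then set2bits (w y) (p y) else w y].

Lemma first_touchP (w : radii) : p (first_touch w) <= rad (w (first_touch w)) /\
  forall x : 'I_n, x < first_touch w -> rad (w x) < p x.
Proof.
rewrite /first_touch; case: arg_minnP => [|y py ymin]; first by rewrite pu.
split=> // x xy; rewrite ltnNge; apply: contraTN xy => /ymin.
by rewrite -leqNgt.
Qed.

Lemma first_touch_uniq (w : radii) (y : 'I_n) : p y <= rad (w y) ->
  (forall x : 'I_n, x < y -> rad (w x) < p x) -> first_touch w = y.
Proof.
move=> py yx; have [pf fx] := first_touchP w; apply: val_inj => /=.
case: (ltngtP (first_touch w) y) => // [/yx|/fx]; lia.
Qed.

(* Memorylessness as counting: forcing two bits of the first touching vertex to
   [true] makes it sharp without changing which vertex touches first, and the map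
   is at most 4-to-1, because those two bits are all that it forgets. *)
Lemma card_sharp : #|{: radii}| <= 4 * #|sharp| + #|overflow|.
Proof.
have safe (w : radii) : w \notin overflow -> (p (first_touch w)).+1 < B.
  rewrite inE negb_exists => /forallP /(_ (first_touch w)).
  have [pf _] := first_touchP w; lia.
have big (w : radii) : w \notin overflow ->
    (p (first_touch w)).+1 < rad (enlarge w (first_touch w)).
  move=> /safe wB; rewrite ffunE eqxx rad_set2bits //.
  by have [] := first_touchP w.
have small (w : radii) (x : 'I_n) : x < first_touch w -> rad (enlarge w x) < p x.
  move=> xf; rewrite ffunE ifN; first by have [_ ->] := first_touchP w.
  by rewrite -val_eqE neq_ltn xf.
have enlarge_sharp (w : radii) : w \notin overflow -> enlarge w \in sharp.
  move=> wo; rewrite inE; apply/existsP; exists (first_touch w).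
  by rewrite big //=; apply/forallP => x; apply/implyP; exact: small.
have enlarge_first (w : radii) : w \notin overflow -> first_touch (enlarge w) = first_touch w.
  move=> wo; apply: first_touch_uniq (small w).
  by have := big w wo; lia.
pose bits (w : radii) := (nth false (w (first_touch w)) (p (first_touch w)),
                nth false (w (first_touch w)) (p (first_touch w)).+1).
have inj : {in ~: overflow &, injective (fun w : radii => (enlarge w, bits w))}.
  move=> w w'; rewrite !inE -/overflow => wo w'o [ee e1 e2].
  have ef : first_touch w = first_touch w'.
    by rewrite -enlarge_first ?inE // ee enlarge_first ?inE.
  apply/ffunP => x; have := congr1 (fun f : radii => f x) ee.
  rewrite !ffunE -ef; case: eqP => // ex es.
  apply/val_inj/(@eq_from_nth _ false) => [|i]; first by rewrite !size_tuple.
  rewrite size_tuple => iB; rewrite -ef -ex in e1 e2.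
  have := congr1 (fun t : B.-tuple bool => nth false t i) es.
  rewrite !nth_set2bits //.
  by case: (eqVneq i (p x)) => [->|] //; case: (eqVneq i (p x).+1) => [->|].
rewrite -(cardsC overflow) addnC leq_add2r -(card_in_imset inj).
apply: (@leq_trans #|setX sharp [set: bool * bool]|); last first.
  by rewrite cardsX cardsT card_prod card_bool mulnC.
apply/subset_leq_card/subsetP => _ /imsetP[w wo ->].
by rewrite in_setX in_setT andbT enlarge_sharp -?in_setC.
Qed.

End Radii.

(** * Splitting a seed into [K] independent clusterings *)

Section Blocks.
Local Open Scope nat_scope.
Variables (n K B : nat).

Definition block (k : nat) (t : seq bool) : B.-tuple bool :=
  [tuple nth false t (k * B + i) | i < B].

Definition blocks (rho : {ffun 'I_n -> (K * B).-tuple bool}) :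
    {ffun 'I_K -> {ffun 'I_n -> B.-tuple bool}} :=
  [ffun k => [ffun v => block (val k) (rho v)]].

Lemma blocks_inj : injective blocks.
Proof.
move=> rho rho' e; apply/ffunP => v; apply/val_inj/(@eq_from_nth _ false).
  by rewrite !size_tuple.
move=> i; rewrite size_tuple => iKB.
have B0 : 0 < B by case: (B) iKB; rewrite ?muln0.
have kK : i %/ B < K by rewrite ltn_divLR.
have jB : i %% B < B by rewrite ltn_mod.
have := congr1 (fun f : {ffun 'I_K -> {ffun 'I_n -> B.-tuple bool}} => tnth (f (Ordinal kK) v) (Ordinal jB)) e.
by rewrite /blocks !ffunE !tnth_mktuple /= -divn_eq.
Qed.

(** Independence as counting: [blocks] embeds the seeds into [K]-tuples of clusterings. *)
Lemma card_all_blocks (Bad : {set {ffun 'I_n -> B.-tuple bool}}) :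
  #|[set rho | [forall k, blocks rho k \in Bad]]| <= #|Bad| ^ K.
Proof.
rewrite -(card_imset _ blocks_inj) -[K in leqRHS](card_ord K) -card_ffun_on.
apply/subset_leq_card/subsetP => _ /imsetP[rho + ->].
by rewrite inE => /forallP bad; apply/ffun_onP.
Qed.

Lemma card_seeds : #|{: {ffun 'I_n -> (K * B).-tuple bool}}| =
  #|{: {ffun 'I_n -> B.-tuple bool}}| ^ K.
Proof.
by rewrite !card_ffun !card_tuple card_bool -!expnM; congr (_ ^ _); lia.
Qed.

End Blocks.

(** * Constant probability that an out-neighbourhood is not split *)

Section Padding.
Local Open Scope nat_scope.
Variables (R : realType) (n B : nat) (m : 'I_n -> 'I_n -> option R) (u : 'I_n).

Definition padded : {set {ffun 'I_n -> B.-tuple bool}} :=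
  [set w : {ffun 'I_n -> B.-tuple bool} | [forall z, isSome (m u z) ==>
    (center m (fun y => rad (w y)) z == center m (fun y => rad (w y)) u)]].

(* [reach y] is the least radius [s] such that the ball of [y] of radius [s] meets
   the ball of [u] of radius 1, and the junk value [B.+1] beyond the truncation. *)
Let reach (y : 'I_n) : nat := find (fun s => near m s.+1 u y) (iota 0 B.+1).

(** The witness [y] of sharpness is the center of the whole unit ball of [u]: its ball contains that
    unit ball, and the balls of smaller vertices miss it. *)
Lemma sharp_padded : sharp B reach \subset padded.
Proof.
apply/subsetP => w; rewrite !inE => /existsP[y /andP[yw /forallP yx]].
have uy : near m (reach y).+1 u y.
  (* The radius of [y] exceeds [reach y], which excludes the junk value. *)
  have ryB : reach y < B.+1 by exact: leqW (leq_trans (ltnW yw) (rad_leq _)).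
  have : has (fun s => near m s.+1 u y) (iota 0 B.+1) by rewrite has_find size_iota.
  by move=> /(nth_find 0); rewrite nth_iota.
have cE z : near m 1 u z -> center m (fun y => rad (w y)) z = y.
  move=> uz; apply: center_min => [|x xy].
    by apply: near_leq (near_trans (near_sym uz) uy); rewrite add1n.
  have := implyP (yx x) xy => xr; have := before_find 0 xr.
  rewrite nth_iota ?add0n => [/negbT|]; last by rewrite ltnS rad_leq.
  by apply: contra => zx; have := near_trans uz zx; rewrite add1n.
apply/forallP => z; apply/implyP => uz; apply/eqP.
by rewrite !cE ?near_refl //; apply: near_adj; rewrite /adj uz.
Qed.

(** At least half of the outcomes do not overflow, and a quarter of that many are sharp: padding has
    probability at least 1/8. *)
Lemma card_unpadded : 4 * n <= 2 ^ B ->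
  8 * #|~: padded| <= 7 * #|{: {ffun 'I_n -> B.-tuple bool}}|.
Proof.
move=> nB; have r0 : reach u = 0 by rewrite /reach /= eqxx.
have arith T G O P Q :
  T <= 4 * G + O -> 2 * O <= T -> G <= P -> P + Q = T -> 8 * Q <= 7 * T by lia.
exact: arith (card_sharp B r0) (card_overflow nB) (subset_leq_card sharp_padded)
  (cardsC padded).
Qed.

End Padding.

(** * The distributed algorithm *)

Section Flooding.
Variables (R : realType) (n K B : nat).

Definition local_data : Type :=
  ('I_n -> option R) * ('I_n -> option R) * (K * B).-tuple bool.
Definition knowledge : Type := 'I_n -> option local_data.

(** Each arc is recorded at both ends, so all arcs incident to a known vertex can be read off. *)
Definition known_net (k : knowledge) : 'I_n -> 'I_n -> option R := fun a b =>
  if k a is Some (out_a, _, _) then out_a b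
  else if k b is Some (_, in_b, _) then in_b a else None.

Definition known_rad (k : knowledge) : 'I_K -> 'I_n -> nat := fun j a =>
  if k a is Some (_, _, t) then rad (block B j t) else 0%N.

(** The choice of informant is harmless: in a run, all of them relay the same initial data of
    [w]. *)
Definition merge (k : knowledge) (inbox : 'I_n -> option knowledge) : knowledge :=
  fun w => if k w is Some x then Some x else
    if [pick u | isSome (obind (fun k' => k' w) (inbox u))] is Some u
    then obind (fun k' => k' w) (inbox u) else None.

Definition flooding : local_alg R n := {|
  la_state := nat * 'I_n * knowledge;
  la_msg := knowledge;
  la_bits := K * B;
  la_rounds := 3 * B;
  la_init := fun r v out_v in_v t =>
    (r, v, fun w => if w == v then Some (out_v, in_v, t) else None);
  la_send := fun s _ => s.2;
  la_recv := fun s inbox => (s.1, merge s.2 inbox);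
  la_out := fun s => pieces s.1.1 (known_net s.2) (known_rad s.2) s.1.2
|}.

Variables (E : rel 'I_n) (c : 'I_n -> 'I_n -> R) (r : nat) (rho : seeds flooding).

Definition ball_knowledge (t : nat) (v : 'I_n) : knowledge := fun w =>
  if near (net E c) t v w then Some (view_out E c w, view_in E c w, rho w) else None.

Lemma adj_net u v : adj (net E c) u v = adjacent E u v.
Proof. by rewrite /adj !isSome_net. Qed.

Lemma gathered t v :
  iter t (@round R n flooding E) (init_states E c r rho) v = (r, v, ball_knowledge t v).
Proof.
elim: t v => [|t IHt] v.
  congr (_, _, _); apply/funext => w; rewrite /ball_knowledge /= eq_sym.
  by case: eqP => // ->.
rewrite iterS /round /= IHt /=; congr (_, _, _); apply/funext => w.
rewrite /merge /ball_knowledge /=; case: (near _ t v w) => //=.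
have inboxE u : obind (fun k' : knowledge => k' w)
    (if adjacent E u v then
       Some (iter t (@round R n flooding E) (init_states E c r rho) u).2 else None) =
    if adj (net E c) u v && near (net E c) t u w
    then Some (view_out E c w, view_in E c w, rho w) else None.
  by rewrite -adj_net; case: (adj _ u v) => //=; rewrite IHt.
case: pickP => [u|none].
  rewrite inboxE; case: ifP => // uw _.
  by rewrite ifT //; apply/existsP; exists u.
rewrite ifF //; apply/negbTE; rewrite negb_exists; apply/forallP => u.
by have := none u; rewrite inboxE; case: ifP.
Qed.

Definition seed_rad : 'I_K -> 'I_n -> nat := fun j a => rad (block B j (rho a)).

Lemma output_flooding u v :
  output E c r rho u v = E u v && pieces r (net E c) seed_rad u v.
Proof.
rewrite /output /final_states gathered /=; congr andb; apply/esym.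
apply: (@pieces_local R n _ _ B) => [a b ua|j a|j a|j a ua].
- rewrite /known_net /ball_knowledge ua; split => //.
  (* The arc [(b, a)] is read at [b] if [b] is known, and otherwise from the incoming view of
     [a]. *)
  by case: ifP.
- exact: rad_leq.
- by rewrite /known_rad; case: (ball_knowledge _ _ _) => // -[[_ _] s]; exact: rad_leq.
- by rewrite /known_rad /ball_knowledge ua.
Qed.

End Flooding.

(** * Failure probability *)

Lemma leq_wexp2r m n e : (m <= n -> m ^ e <= n ^ e)%N.
Proof. by case: e => // e mn; rewrite leq_exp2r. Qed.

Lemma amplification n L : (n <= 2 ^ L -> n * n * 7 ^ (12 * L) <= 8 ^ (12 * L))%N.
Proof.
move=> nL; apply: (@leq_trans (2 ^ L * 2 ^ L * 7 ^ (12 * L))%N).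
  by rewrite leq_mul2r leq_mul ?orbT.
have leL : (2 ^ L * 7 ^ (6 * L) <= 8 ^ (6 * L))%N.
  (* Six repetitions at rate 7/8 gain a factor 2, so [6 * L] of them absorb one factor [n], and
     [12 * L] absorb two. *)
  have le6 : (2 * 7 ^ 6 <= 8 ^ 6)%N by lia.
  by rewrite !expnM -expnMn; exact: leq_wexp2r le6.
rewrite (_ : 12 * L = 6 * L + 6 * L)%N; last by lia.
by rewrite (expnD 7) (expnD 8) mulnACA leq_mul.
Qed.

Section Failure.
Variables (R : realType) (n L : nat) (E : rel 'I_n) (c : 'I_n -> 'I_n -> R) (r : nat).
Hypothesis nL : (n <= 2 ^ L)%N.
Local Notation alg := (flooding R n (12 * L) (L + 2)).

(** A vertex is unpadded in all [K] clusterings with probability at most [(7/8) ^ K]. One factor [n]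
    pays for the union bound over vertices, the other for the target [1/n]. *)
Lemma card_failures :
  (n * #|[set rho : seeds alg | ~~ `[< ft2spanner E r (output E c r rho) >]]|
     <= #|seeds alg|)%N.
Proof.
set T := #|seeds alg|; set K := (12 * L)%N; set bad := [set rho | _].
pose fail u := [set rho : seeds alg |
  [forall k, blocks rho k \in ~: padded (L + 2) (net E c) u]].
have bad_sub : bad \subset \bigcup_u fail u.
  apply/subsetP => rho; rewrite inE; apply: contraR => nfail.
  apply/asboolP/covered_ft2spanner => a b Eab neq_ab.
  have : rho \notin fail a by apply: contra nfail => ?; apply/bigcupP; exists a.
  rewrite inE negb_forall => /existsP[k]; rewrite !inE negbK => /forallP pad.
  have -> : output E c r rho = fun u v => E u v && pieces r (net E c) (seed_rad rho) u v.
    by apply/funext => u; apply/funext => v; exact: output_flooding.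
  apply: (@pieces_covered R n E c r K (seed_rad rho) a b k) => // z Eaz.
  have := implyP (pad z); rewrite isSome_net => /(_ Eaz) /eqP.
  rewrite (_ : (fun y => rad _) = seed_rad rho k) //.
  by apply/funext => y; rewrite /blocks !ffunE.
have fail_card u : (8 ^ K * #|fail u| <= 7 ^ K * T)%N.
  have unp : (8 * #|~: padded (L + 2) (net E c) u| <=
              7 * #|{: {ffun 'I_n -> (L + 2).-tuple bool}}|)%N.
    (* The 2 in [L + 2] supplies the factor 4 of [4 * n <= 2 ^ B]. *)
    by apply: card_unpadded; rewrite expnD mulnC leq_mul2r nL orbT.
  apply: (@leq_trans (8 ^ K * #|~: padded (L + 2) (net E c) u| ^ K)%N).
    by rewrite leq_mul2l card_all_blocks orbT.
  by rewrite /T /seeds /= card_seeds -!expnMn; exact: leq_wexp2r unp.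
have bad_card : (8 ^ K * #|bad| <= n * (7 ^ K * T))%N.
  apply: (@leq_trans (8 ^ K * \sum_u #|fail u|)%N).
    rewrite leq_mul2l (leq_trans (subset_leq_card bad_sub) (card_bigcup_leq _)).
    by rewrite orbT.
  rewrite big_distrr /= -[n in leqRHS]card_ord -sum_nat_const.
  exact: leq_sum.
rewrite -(leq_pmul2l (expn_gt0 8 K)).
have amp := amplification nL.
apply: (@leq_trans (n * n * 7 ^ K * T)%N); last by rewrite leq_mul2r amp orbT.
by rewrite mulnCA -!mulnA leq_mul2l bad_card orbT.
Qed.

End Failure.

Lemma prob_ge_1minusV (R : realType) (T : finType) (P : T -> Prop) (n : nat) :
  (0 < n)%N -> (0 < #|T|)%N -> (n * #|[set x | ~~ `[< P x >]]| <= #|T|)%N ->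
  1 - n%:R^-1 <= prob R P.
Proof.
move=> n0 T0 nbad; rewrite /prob.
have cardP : (#|[set x | `[< P x >]]| + #|[set x | ~~ `[< P x >]]| = #|T|)%N.
  rewrite -(cardsC [set x | `[< P x >]]); congr addn; apply: eq_card => x.
  by rewrite !inE.
have nR : 0 < n%:R :> R by rewrite ltr0n.
have TR : 0 < #|T|%:R :> R by rewrite ltr0n.
rewrite ler_pdivlMr // mulrBl mul1r lerBlDr -[in leLHS]cardP natrD lerD2l.
by rewrite mulrC ler_pdivlMr // -natrM mulnC ler_nat.
Qed.

Theorem theorem1p3 (R : realType) :
  exists (C : nat) (A : forall n : nat, local_alg R n),
  forall n : nat,
    (@la_rounds R n (A n) <= C * (trunc_log 2 n).+1 ^ 2)%N /\
    forall (E : rel 'I_n) (c : 'I_n -> 'I_n -> R) (r : nat),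
      (forall u v, 0 <= c u v) ->
      1 - n%:R^-1 <= @prob R _ (fun rho : seeds (A n) => ft2spanner E r (output E c r rho))
      /\
      forall E' : rel 'I_n, subgraph E' E -> ft2spanner E r E' ->
        expect (fun rho : seeds (A n) => cost c (output E c r rho))
          <= (C * (trunc_log 2 n).+1)%:R * cost c E'.
Proof.
(* The [12 * L] clusterings fix the constant through the cost; the [3 * (L + 2)] rounds then fit
   below [12 * L ^ 2]. *)
exists 12%N, (fun n => flooding R n (12 * (trunc_log 2 n).+1) ((trunc_log 2 n).+1 + 2)).
move=> n; set L := (trunc_log 2 n).+1.
have nL : (n <= 2 ^ L)%N by apply/ltnW/trunc_log_ltn.
split=> [|E c r c_ge0]; first by rewrite /=; have : (0 < L)%N by []; nia.
set A := flooding R n _ _.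
have T0 : (0 < #|seeds A|)%N by rewrite card_ffun card_tuple card_bool !expn_gt0.
split=> [|E' sE'E E'span].
  (* Without vertices there are no arcs to cover, and every outcome succeeds. *)
  have [n0|n_gt0] := posnP n; last exact: prob_ge_1minusV (card_failures E c r nL).
  rewrite /prob (_ : [set _ | _] = setT).
    by rewrite cardsT divff ?pnatr_eq0 -?lt0n // lerBlDr lerDl invr_ge0 ler0n.
  apply/setP => rho; rewrite !inE; apply/asboolP/covered_ft2spanner => a.
  by have := ltn_ord a; rewrite {2}n0.
(* The cost bound holds for every seed, so it passes to the average. *)
rewrite /expect ler_pdivrMr ?ltr0n // mulr_natr -sumr_const.
apply: ler_sum => rho _.
have := pieces_cost c_ge0 sE'E E'span (seed_rad rho).
congr (_ <= _); apply: eq_bigr => u _; apply: eq_bigl => v.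
by rewrite output_flooding.
Qed.
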